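(* Consider a network with excited nodes $\mathcal B$ ($|\mathcal B|=n_B$), measured nodes $\mathcal C$ ($|\mathcal C|=n_C$), known edges $E^0$ and unknown edges $E^\Delta$, with $|E^\Delta|=n_Bn_C$. Then: (1) If the network is generically decoupled-identifiable, then there is at least one connected bijective assignation $\sigma:E^\Delta\to\mathcal B\times\mathcal C$. (2) If there is exactly one connected bijective assignation $\sigma:E^\Delta\to\mathcal B\times\mathcal C$, then the network is generically decoupled-identifiable.
   Context: Network. There are $n$ nodes, a set $\mathcal B$ of $n_B$ excited nodes and a set $\mathcal C$ of $n_C$ measured nodes. $B\in\{0,1\}^{n\times n_B}$ is the selection matrix of $\mathcal B$ (each column has exactly one 1, marking an excited node; full column rank); $C\in\{0,1\}^{n_C\times n}$ is the selection matrix of $\mathcal C$ (each row has exactly one 1, marking a measured node; full row rank). The topology is a directed graph on the nodes with edge set $E$, the disjoint union of known edges $E^0$ and unknown edges $E^\Delta$; the edge from $j$ (start node) to $i$ (end node) corresponds to the matrix entry $(i,j)$. A single frequency is considered, so transfer functions are complex numbers. A network matrix is $G=G^0+G^\Delta\in\mathbb C^{n\times n}$, with $G^0$ supported on $E^0$ and $G^\Delta$ supported on $E^\Delta$. Well-posedness is assumed throughout: only $G$ with $I-G$ invertible are considered; $T(G)=(I-G)^{-1}$. Decoupled identifiability. For $G=G^0+G^\Delta$ and $G'=G^0+G'^\Delta$ (same zero entries and same known entries), the network is decoupled-identifiable at $(G,G')$ if for all $\Delta\in\mathbb C^{n\times n}$ supported on $E^\Delta$: $C\,T(G)\,\Delta\,T(G')\,B=0\Rightarrow\Delta=0$.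 The network is generically decoupled-identifiable if this holds for almost all $(G,G')$, i.e. for almost all values of the known entries $G^0$ (shared by $G$ and $G'$), the unknown entries $G^\Delta$ and the unknown entries $G'^\Delta$; ''almost all'' means all except possibly those lying on a lower-dimensional set (a set of dimension lower than that of the parameter space, for instance one contained in the zero set of a nonzero polynomial). Assignations. A bijective assignation is a bijection $\sigma:E^\Delta\to\mathcal B\times\mathcal C$, written $\sigma(\alpha)=(\sigma_B(\alpha),\sigma_C(\alpha))$. Paths are directed, possibly of length zero. Connectivity is read in the decoupled graph: two copies of the graph (left copy carrying the excitations, right copy carrying the measurements), with each unknown edge $\alpha=(j\to i)$ additionally giving an edge from the left copy of $j$ to the right copy of $i$. The assignation $\sigma$ is connected if for each unknown edge $\alpha$ there is a path from its assigned excitation $\sigma_B(\alpha)$ (left copy) to its assigned measurement $\sigma_C(\alpha)$ (right copy) in which $\alpha$ is included; equivalently, in the original graph there is a path from $\sigma_B(\alpha)$ to the start node of $\alpha$ and a path from the end node of $\alpha$ to $\sigma_C(\alpha)$. *)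

(* Defs.v *)
From mathcomp Require Import all_boot all_order all_algebra.
From mathcomp Require Import reals complex mpoly.

Set Implicit Arguments.
Unset Strict Implicit.
Unset Printing Implicit Defensive.

Import GRing.Theory.
Local Open Scope ring_scope.

Section Network.

Variables (R : realType) (n : nat).
Local Notation C := (complex R).
Implicit Types (E ED : {set 'I_n * 'I_n}) (S : {set 'I_n}).

(* The edge from j to i is the pair (i, j), like the matrix entry it carries. *)
Definition supported E (M : 'M[C]_n) : Prop :=
  forall i j, (i, j) \notin E -> M i j = 0.

Definition excitation_mx S : 'M[C]_(n, #|S|) :=
  \matrix_(i, k) (i == enum_val k)%:R.

Definition measurement_mx S : 'M[C]_(#|S|, n) :=
  \matrix_(k, i) (i == enum_val k)%:R.

Definition well_posed (G : 'M[C]_n) : bool := 1%:M - G \in unitmx.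

Definition transfer (G : 'M[C]_n) : 'M[C]_n := invmx (1%:M - G).

Definition decoupled_identifiable_at (Bs Cs : {set 'I_n}) ED
    (G G' : 'M[C]_n) : Prop :=
  forall D : 'M[C]_n, supported ED D ->
    measurement_mx Cs *m transfer G *m D *m transfer G' *m excitation_mx Bs = 0 ->
    D = 0.

(* Coordinates of the parameter space: the entries of G0 on the known edges,
   followed by those of GD and of GD' on the unknown edges. Entries outside
   the edge set are not coordinates: a polynomial involving them could be
   nonzero and yet vanish identically on the parameter space. *)
Definition parameters E0 ED (G0 GD GD' : 'M[C]_n)
    (k : 'I_(#|E0| + (#|ED| + #|ED|))) : C :=
  match split k with
  | inl a => G0 (enum_val a).1 (enum_val a).2
  | inr l =>
    match split l with
    | inl b => GD (enum_val b).1 (enum_val b).2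
    | inr b => GD' (enum_val b).1 (enum_val b).2
    end
  end.

(* "Almost all" means outside the zero set of a nonzero polynomial, i.e. outside
   a set whose Zariski closure has smaller dimension than the parameter space. *)
Definition generically_decoupled_identifiable (Bs Cs : {set 'I_n}) E0 ED
    : Prop :=
  exists2 p : {mpoly C[#|E0| + (#|ED| + #|ED|)]}, p != 0 &
    forall G0 GD GD' : 'M[C]_n,
      supported E0 G0 -> supported ED GD -> supported ED GD' ->
      p.@[parameters (E0 := E0) (ED := ED) G0 GD GD'] != 0 ->
      well_posed (G0 + GD) -> well_posed (G0 + GD') ->
      decoupled_identifiable_at Bs Cs ED (G0 + GD) (G0 + GD').

End Network.

Section Assignations.

Variable n : nat.
Implicit Types (E ED : {set 'I_n * 'I_n}).

(* inl and inr are the left (excitation) and right (measurement) copies. *)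
Definition decoupled_edge E0 ED : rel ('I_n + 'I_n) := fun u v =>
  match u, v with
  | inl j, inl i => (i, j) \in E0 :|: ED
  | inr j, inr i => (i, j) \in E0 :|: ED
  | inl j, inr i => (i, j) \in ED
  | inr _, inl _ => false
  end.

(* A path x :: s, possibly of length zero before and after the crossing, that
   traverses the edge from the left copy of a.2 to the right copy of a.1. *)
Definition path_through E0 ED (a : 'I_n * 'I_n) (b c : 'I_n) : Prop :=
  exists s1 s2 : seq ('I_n + 'I_n),
    [/\ path (decoupled_edge E0 ED) (inl b) (s1 ++ inr a.1 :: s2),
        last (inl b) s1 = inl a.2
      & last (inr a.1) s2 = inr c].

Definition assignation ED (Bs Cs : {set 'I_n}) : Type :=
  {ffun {a | a \in ED} -> {b | b \in Bs} * {c | c \in Cs}}.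

Definition connected_assignation E0 ED (Bs Cs : {set 'I_n})
    (sigma : assignation ED Bs Cs) : Prop :=
  forall a : {a | a \in ED},
    path_through E0 ED (val a) (val (sigma a).1) (val (sigma a).2).

Definition connected_bijective_assignation E0 ED (Bs Cs : {set 'I_n})
    (sigma : assignation ED Bs Cs) : Prop :=
  bijective sigma /\ connected_assignation E0 sigma.

End Assignations.

(* Main.v *)
Require Import Defs.
From mathcomp Require Import all_boot all_order all_algebra.
From mathcomp Require Import reals complex mpoly.
From mathcomp Require Import perm.

Set Implicit Arguments.
Unset Strict Implicit.
Unset Printing Implicit Defensive.

Import Order.TTheory GRing.Theory Num.Theory.
Local Open Scope ring_scope.

(** Write T = T(G) and T' = T(G'). Since there are as many unknown edges as
    (excitation, measurement) pairs, the equation C T Delta T' B = 0 is a square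
    linear system in the entries of Delta. Its matrix, [sensitivity_mx], has the
    entry T c i * T' j b in the row of the edge (i, j) and the column of the pair
    (b, c), and the network is identifiable at (G, G') exactly when its
    determinant does not vanish ([identifiable_atP]).

    In the Leibniz expansion of this determinant the permutations are the
    bijective assignations. A transfer entry T c i vanishes identically unless a
    path leads from i to c ([invmx_support]), so only connected assignations
    contribute.

    (1) A nonzero polynomial over an infinite field has a nonroot
    ([mpoly_nonroot]); hence generic identifiability yields a well-posed pair at
    which the determinant is nonzero, thus a nonzero Leibniz term, which is a
    connected assignation ([exists_connected]).

    (2) If a single assignation is connected, the determinant is up to sign one
    product of transfer entries, and no cancellation can occur
    ([det_unique_connected]). Replacing inverses by adjugates clears the
    denominators and gives a polynomial in the parameters. This polynomial is not
    zero, because all edges can be given one small positive weight: then all the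
    entries of (I - G)^-1 that a path allows to be nonzero are positive
    simultaneously ([uniform_weights]). *)

(** * Nonroots of multivariate polynomials *)

Lemma digits_inj d n (f g : 'I_n -> nat) :
  (forall i, f i < d)%N -> (forall i, g i < d)%N ->
  (\sum_i f i * d ^ i = \sum_i g i * d ^ i)%N -> f =1 g.
Proof.
elim: n f g => [|n IHn] f g ltfd ltgd eqfg; first by case.
have shift (h : 'I_n.+1 -> nat) :
    (\sum_i h i * d ^ i = (\sum_(i < n) h (lift ord0 i) * d ^ i) * d + h ord0)%N.
  rewrite big_ord_recl muln1 addnC big_distrl; congr (_ + _)%N.
  by apply: eq_bigr => i _; rewrite /= -mulnA -expnSr.
have d_gt0 : (0 < d)%N := leq_ltn_trans (leq0n _) (ltfd ord0).
rewrite !shift in eqfg.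
have eq0 : f ord0 = g ord0.
  by have := congr1 (modn^~ d) eqfg; rewrite !modnMDl !modn_small.
have eqS : (\sum_(i < n) f (lift ord0 i) * d ^ i
            = \sum_(i < n) g (lift ord0 i) * d ^ i)%N.
  by have := congr1 (divn^~ d) eqfg; rewrite !divnMDl // !divn_small // !addn0.
move=> i; have [j ->|->] := unliftP ord0 i; last exact: eq0.
exact: (IHn (fun i => f (lift ord0 i)) (fun i => g (lift ord0 i))).
Qed.

Lemma poly_nonroot (F : numFieldType) (p : {poly F}) :
  p != 0 -> exists t, p.[t] != 0.
Proof.
move=> nz_p; pose s := [seq i%:R : F | i <- iota 0 (size p)].
have /allPn[t _ pt] : ~~ all (root p) s.
  apply/negP => roots_s; have uniq_s : uniq s.
    by rewrite map_inj_uniq ?iota_uniq //; apply: mulrIn; exact: oner_neq0.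
  by have := max_poly_roots nz_p roots_s uniq_s; rewrite size_map size_iota ltnn.
by exists t.
Qed.

(** Kronecker substitution: with d larger than every exponent, replacing the
    variable of index i by t ^ (d ^ i) sends distinct monomials to distinct
    powers of t, so p becomes a nonzero univariate polynomial. *)
Lemma mpoly_nonroot (F : numFieldType) n (p : {mpoly F[n]}) :
  p != 0 -> exists x, p.@[x] != 0.
Proof.
move=> nz_p; pose d := (msize p).+1.
pose code (m : 'X_{1..n}) := (\sum_i m i * d ^ i)%N.
have code_inj : {in msupp p &, injective code}.
  move=> m m' pm pm' eq_code; apply/mnmP; apply: digits_inj eq_code => i.
    rewrite ltnS; apply: leq_trans (ltnW (msize_mdeg_lt pm)).
    by rewrite mdegE (bigD1 i) //= leq_addr.
  rewrite ltnS; apply: leq_trans (ltnW (msize_mdeg_lt pm')).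
  by rewrite mdegE (bigD1 i) //= leq_addr.
pose P : {poly F} := \sum_(m <- msupp p) p@_m *: 'X^(code m).
have [m0 pm0] : exists m0, m0 \in msupp p.
  case supp_p: (msupp p) => [|m0 s]; last by exists m0; rewrite mem_head.
  by rewrite -msupp_eq0 supp_p in nz_p.
have nz_P : P != 0.
  apply: contraTneq (pm0) => P0; rewrite -mcoeff_eq0; apply/eqP.
  have := coef0 F (code m0); rewrite -P0 coef_sum (bigD1_seq m0) //=.
  rewrite coefZ coefXn eqxx mulr1 big_seq_cond big1 ?addr0 => [->//|].
  move=> m /andP[pm nm]; rewrite coefZ coefXn.
  case: eqP => [eqm|]; last by rewrite mulr0.
  by rewrite (code_inj _ _ pm0 pm eqm) eqxx in nm.
have [t Pt] := poly_nonroot nz_P; exists (fun i => t ^+ (d ^ i)).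
rewrite mevalE; move: Pt; rewrite horner_sum; congr (_ != 0).
apply: eq_bigr => m _; rewrite hornerZ hornerXn /code -prodrXr; congr (_ * _).
by apply: eq_bigr => i _; rewrite -exprM mulnC.
Qed.

(** * Entries of the transfer matrix and paths *)

(** Let U project onto the coordinates from which c can be reached. Right
    multiplication by I - G maps the row space of U into itself, hence onto itself
    by equality of ranks, so the inverse preserves it too; it contains row c of
    the inverse because it contains the c-th unit row vector. *)
Lemma invmx_support (F : fieldType) n (G : 'M[F]_n) (e : rel 'I_n) c i :
    (forall i j, G i j != 0 -> e j i) -> 1%:M - G \in unitmx ->
  invmx (1%:M - G) c i != 0 -> connect e i c.
Proof.
move=> suppG unitG; set M := 1%:M - G in unitG *.
pose U : 'M[F]_n := diag_mx (\row_j (connect e j c)%:R).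
have inU m (x : 'M[F]_(m, n)) :
    (forall k j, x k j != 0 -> connect e j c) -> x = x *m U.
  move=> suppx; apply/matrixP=> k j; rewrite mul_mx_diag !mxE.
  have [->|/suppx ->] := eqVneq (x k j) 0; first by rewrite mul0r.
  by rewrite mulr1.
have UM : (U *m M <= U)%MS.
  rewrite (inU _ (U *m M)) ?submxMl // => k j; rewrite mul_diag_mx !mxE.
  case kc: (connect e k c); last by rewrite mul0r eqxx.
  rewrite mul1r; have [<- //|nkj] := eqVneq k j.
  by rewrite sub0r oppr_eq0 => /suppG /connect1 /connect_trans; apply.
have UiM : (U *m invmx M <= U)%MS.
  have : (U <= U *m M)%MS.
    by rewrite -(geq_leqif (mxrank_leqif_sup UM)) mxrankMfree ?row_free_unit.
  by move/(submxMr (invmx M)); rewrite mulmxK.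
have rowc : (row c (invmx M) <= U)%MS.
  apply: submx_trans UiM; rewrite (_ : row c _ = row c (U *m invmx M)) ?row_sub //.
  by apply/rowP=> j; rewrite mul_diag_mx !mxE connect0 mul1r.
case/submxP: rowc => y /matrixP/(_ ord0 i); rewrite mul_mx_diag !mxE => ->.
by case: (connect e i c) => //; rewrite mulr0 eqxx.
Qed.

Section Positivity.
Variables (R : realFieldType) (n : nat) (G : 'M[R]_n).
Hypotheses (G_ge0 : forall i j, 0 <= G i j) (G_lt1 : forall i, \sum_j G i j < 1).

(** A negative minimal coordinate x m is impossible: it would be at least the
    weighted sum of the x j, hence at least (\sum_j G m j) * x m > x m. *)
Lemma min_principle (x : 'cV[R]_n) :
  (forall i, 0 <= ((1%:M - G) *m x) i 0) -> forall i, 0 <= x i 0.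
Proof.
move=> ge0 i0.
have [m _ minm] := @arg_minP _ _ _ i0 predT (fun i => x i 0) isT.
apply: le_trans (minm i0 isT); rewrite leNgt; apply/negP => xm_lt0.
have := ge0 m; rewrite mulmxBl mul1mx !mxE subr_ge0 leNgt => /negP; apply.
apply: (@lt_le_trans _ _ ((\sum_j G m j) * x m 0)).
  by rewrite ltr_nMl.
rewrite mulr_suml; apply: ler_sum => j _; exact: ler_wpM2l (minm j isT).
Qed.

(** Both x and - x satisfy the minimum principle when x is in the kernel. *)
Lemma unitmx_substochastic : 1%:M - G \in unitmx.
Proof.
rewrite -unitmx_tr -row_free_unit -kermx_eq0; apply/eqP/matrixP => k i.
set x := (row k (kermx (1%:M - G)^T))^T.
have x0 : (1%:M - G) *m x = 0.
  by apply: trmx_inj; rewrite trmx_mul trmxK -row_mul mulmx_ker row0 trmx0.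
have x_ge0 := @min_principle x; have x_le0 := @min_principle (- x).
rewrite mulmxN x0 in x_ge0 x_le0.
have : x i 0 = 0.
  apply/le_anti; rewrite -oppr_ge0 x_ge0 => [|j]; last by rewrite mxE.
  by have := x_le0 _ i; rewrite !mxE andbT; apply=> j; rewrite !mxE oppr0.
by rewrite !mxE.
Qed.

(** Column i of the inverse solves x = delta_i + G x with x nonnegative, so it is
    positive at i, and positivity propagates along the edges. *)
Lemma invmx_pos (e : rel 'I_n) c i :
    (forall i j, e j i -> 0 < G i j) -> connect e i c ->
  0 < invmx (1%:M - G) c i.
Proof.
move=> Ge /connectP[s es ->]; pose x := col i (invmx (1%:M - G)).
have def_x : (1%:M - G) *m x = delta_mx i 0.
  by rewrite /x colE mulmxA mulmxV ?mul1mx ?unitmx_substochastic.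
have x_ge0 : forall j, 0 <= x j 0.
  by apply: min_principle => j; rewrite def_x mxE ler0n.
have xE j : x j 0 = (j == i)%:R + \sum_k G j k * x k 0.
  have /matrixP/(_ j 0) := def_x; rewrite mulmxBl mul1mx !mxE eqxx andbT.
  by move/eqP; rewrite subr_eq => /eqP.
have sum_ge0 j : 0 <= \sum_k G j k * x k 0.
  by apply: sumr_ge0 => k _; apply: mulr_ge0.
have pos_along k t : path e k t -> 0 < x k 0 -> 0 < x (last k t) 0.
  elim: t k => //= j t IHt k /andP[ekj et] xk_gt0; apply: IHt et _.
  rewrite xE ltr_wpDl ?ler0n // (bigD1 k) //= ltr_pwDl ?mulr_gt0 ?Ge //.
  by apply: sumr_ge0 => k' _; apply: mulr_ge0.
have := pos_along _ _ es; rewrite [x (last i s) 0]mxE; apply.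
by rewrite xE eqxx ltr_pwDl ?ltr01.
Qed.
End Positivity.

(** The weight 1 / (n + 1) makes every row sum smaller than 1. The computation is
    done over the reals, where positivity makes sense, and then transported to the
    complex numbers. *)
Lemma uniform_weights (R : realType) n (E : {set 'I_n * 'I_n}) :
  exists z : complex R,
    let M := 1%:M - \matrix_(i, j) (z *+ ((i, j) \in E)) : 'M_n in
    forall c i, (\adj M c i != 0) = connect (fun j i => (i, j) \in E) i c.
Proof.
pose w : R := n.+1%:R^-1; exists (real_complex R w) => M.
pose G : 'M[R]_n := \matrix_(i, j) (w *+ ((i, j) \in E)).
have w_gt0 : 0 < w by rewrite invr_gt0 ltr0n.
have G_ge0 i j : 0 <= G i j by rewrite mxE mulrn_wge0 // ltW.
have G_lt1 i : \sum_j G i j < 1.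
  apply: (@le_lt_trans _ _ (\sum_(j < n) w)).
    by apply: ler_sum => j _; rewrite mxE; case: (_ \in _); rewrite // ltW.
  rewrite sumr_const card_ord -mulr_natl ltr_pdivrMr ?ltr0n // mul1r.
  by rewrite ltr_nat.
have unitG := unitmx_substochastic G_ge0 G_lt1.
have defM : M = map_mx (real_complex R) (1%:M - G).
  rewrite map_mxB map_mx1; congr (_ - _); apply/matrixP=> i j.
  by rewrite !mxE; case: (_ \in E).
have adjE : \adj (1%:M - G) = \det (1%:M - G) *: invmx (1%:M - G).
  by rewrite /invmx unitG scalerA divff ?scale1r // -unitfE -unitmxE.
have nz_det : \det (1%:M - G) != 0 by rewrite -unitfE -unitmxE.
move=> c i; rewrite defM -map_mx_adj mxE fmorph_eq0 adjE mxE mulf_eq0.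
rewrite (negPf nz_det) /=; apply/idP/idP => [|ic].
  apply: invmx_support => // k j; rewrite mxE.
  by case: (_ \in _); rewrite ?eqxx.
by rewrite gt_eqF // (invmx_pos G_ge0 G_lt1 _ ic) // => k j Ekj; rewrite mxE Ekj.
Qed.

(** * Decoupled graph and parameter space *)

(** Stated for arbitrary commutative rings, like [rmorph_det_sensitivity], because
    unification of ring structures is very slow when rewriting directly in
    matrices of multivariate polynomials. *)
Lemma rmorph_det1B (A A' : comNzRingType) (f : {rmorphism A -> A'}) n
    (G : 'M[A]_n) :
  f (\det (1%:M - G)) = \det (1%:M - map_mx f G).
Proof. by rewrite -det_map_mx map_mxB map_mx1. Qed.

Section GenericNetwork.
Variables (n : nat) (E0 ED : {set 'I_n * 'I_n}).

Definition network_edge : rel 'I_n := fun j i => (i, j) \in E0 :|: ED.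

(** Forgetting the side of each copy maps a path of the decoupled graph to a path
    of the original graph, of which the crossing edge is one step. *)
Lemma path_throughP a b c : a \in ED ->
  path_through E0 ED a b c
  <-> connect network_edge b a.2 && connect network_edge a.1 c.
Proof.
case: a => a1 a2 EDa.
pose proj (u : 'I_n + 'I_n) := match u with inl i | inr i => i end.
have projE u v : decoupled_edge E0 ED u v -> network_edge (proj u) (proj v).
  by case: u v => [j|j] [i|i] //= EDij; rewrite /network_edge inE EDij orbT.
have proj_connect u s :
    path (decoupled_edge E0 ED) u s ->
  connect network_edge (proj u) (proj (last u s)).
  move=> us; apply/connectP; exists (map proj s); last by rewrite last_map.
  elim: s u us => //= v s IHs u /andP[/projE -> /IHs]; exact.
split=> [[s1 [s2 []]]|/andP[/connectP[t1 bt1 lt1] /connectP[t2 at2 lt2]]].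
  rewrite cat_path => /andP[/proj_connect + /= /andP[_ /proj_connect]].
  by move=> + + last1 last2; rewrite last1 last2 => -> ->.
exists (map inl t1), (map inr t2); rewrite !last_map -lt1 -lt2; split=> //.
rewrite cat_path last_map -lt1 [path _ _ (_ :: _)]/= EDa.
by rewrite !path_map; apply/andP.
Qed.

Section Coordinates.
Variables (A : nzRingType) (E : {set 'I_n * 'I_n}).

Definition edge_mx (x : 'I_#|E| -> A) : 'M[A]_n :=
  \matrix_(i, j) \sum_(k | enum_val k == (i, j)) x k.

Lemma edge_mx_out x i j : (i, j) \notin E -> edge_mx x i j = 0.
Proof.
move=> ijE; rewrite mxE big_pred0 // => k.
by apply: contraNF ijE => /eqP <-; apply: enum_valP.
Qed.

Lemma edge_mx_val x k : edge_mx x (enum_val k).1 (enum_val k).2 = x k.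
Proof.
rewrite mxE -surjective_pairing (big_pred1 k) // => k'.
by rewrite (inj_eq enum_val_inj).
Qed.

Lemma edge_mxK (M : 'M[A]_n) :
  (forall i j, (i, j) \notin E -> M i j = 0) ->
  edge_mx (fun k => M (enum_val k).1 (enum_val k).2) = M.
Proof.
move=> suppM; apply/matrixP=> i j.
have [ijE|ijE] := boolP ((i, j) \in E); last by rewrite suppM ?edge_mx_out.
pose k := enum_rank_in ijE (i, j).
have kE : enum_val k = (i, j) by rewrite enum_rankK_in.
by have := edge_mx_val (fun k => M (enum_val k).1 (enum_val k).2) k; rewrite kE.
Qed.

Lemma eq_edge_mx x y : x =1 y -> edge_mx x = edge_mx y.
Proof. by move=> eqxy; apply/matrixP=> i j; rewrite !mxE; apply: eq_bigr. Qed.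

End Coordinates.

Lemma map_edge_mx (A A' : nzRingType) (f : {rmorphism A -> A'})
    (E : {set 'I_n * 'I_n}) (x : 'I_#|E| -> A) :
  map_mx f (edge_mx x) = edge_mx (fun k => f (x k)).
Proof. by apply/matrixP=> i j; rewrite !mxE rmorph_sum. Qed.

(** L and R tell on which side of Delta the matrix enters T(G) Delta T(G'). *)
Section Blocks.
Variables (A : nzRingType) (x : 'I_(#|E0| + (#|ED| + #|ED|)) -> A).

Definition known_mx : 'M[A]_n := edge_mx (fun k => x (lshift _ k)).
Definition unknownL_mx : 'M[A]_n :=
  edge_mx (fun k => x (rshift _ (lshift _ k))).
Definition unknownR_mx : 'M[A]_n :=
  edge_mx (fun k => x (rshift _ (rshift _ k))).

End Blocks.

Section ComplexCoordinates.
Variable R : realType.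
Local Notation C := (complex R).

Lemma supported_edge_mx (E : {set 'I_n * 'I_n}) (x : 'I_#|E| -> C) :
  supported E (edge_mx x).
Proof. by move=> i j; apply: edge_mx_out. Qed.

Lemma parametersK (G0 GD GD' : 'M[C]_n) :
  supported E0 G0 -> supported ED GD -> supported ED GD' ->
  let x := parameters (E0 := E0) (ED := ED) G0 GD GD' in
  [/\ known_mx x = G0, unknownL_mx x = GD & unknownR_mx x = GD'].
Proof.
move=> s0 sD sD' x; split.
- rewrite -[RHS](edge_mxK s0); apply: eq_edge_mx => k.
  by rewrite /x /parameters (unsplitK (inl k)).
- rewrite -[RHS](edge_mxK sD); apply: eq_edge_mx => k.
  by rewrite /x /parameters (unsplitK (inr _)) (unsplitK (inl k)).
rewrite -[RHS](edge_mxK sD'); apply: eq_edge_mx => k.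
by rewrite /x /parameters (unsplitK (inr _)) (unsplitK (inr k)).
Qed.

Lemma parameters_surj (x : 'I_(#|E0| + (#|ED| + #|ED|)) -> C) :
  parameters (E0 := E0) (ED := ED) (known_mx x) (unknownL_mx x) (unknownR_mx x)
  =1 x.
Proof.
move=> k; rewrite /parameters -{2}(splitK k); case: (split k) => [a|l] /=.
  by rewrite edge_mx_val.
by rewrite -{2}(splitK l); case: (split l) => b /=; rewrite edge_mx_val.
Qed.

End ComplexCoordinates.

(** G and G' with indeterminate entries on the edges; the indeterminates of the
    known edges are common to both. *)
Definition genericL (F : fieldType) : 'M[{mpoly F[#|E0| + (#|ED| + #|ED|)]}]_n :=
  known_mx (fun k => 'X_k) + unknownL_mx (fun k => 'X_k).
Definition genericR (F : fieldType) : 'M[{mpoly F[#|E0| + (#|ED| + #|ED|)]}]_n :=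
  known_mx (fun k => 'X_k) + unknownR_mx (fun k => 'X_k).

Lemma meval_genericL (F : fieldType) (x : _ -> F) :
  map_mx (meval x) (genericL F) = known_mx x + unknownL_mx x.
Proof.
rewrite /genericL map_mxD !map_edge_mx.
by congr (_ + _); apply: eq_edge_mx => k; rewrite /= mevalXU.
Qed.

Lemma meval_genericR (F : fieldType) (x : _ -> F) :
  map_mx (meval x) (genericR F) = known_mx x + unknownR_mx x.
Proof.
rewrite /genericR map_mxD !map_edge_mx.
by congr (_ + _); apply: eq_edge_mx => k; rewrite /= mevalXU.
Qed.

Definition well_posedness_poly (F : fieldType) :=
  \det (1%:M - genericL F) * \det (1%:M - genericR F).

Lemma meval_well_posedness_poly (F : fieldType) (x : _ -> F) :
  (well_posedness_poly F).@[x] = \det (1%:M - (known_mx x + unknownL_mx x))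
                                 * \det (1%:M - (known_mx x + unknownR_mx x)).
Proof.
rewrite -meval_genericL -meval_genericR.
apply: etrans (mevalM x _ _) _; congr (_ * _); exact: (rmorph_det1B (meval x)).
Qed.

(** At the zero network both determinants equal 1. *)
Lemma well_posedness_poly_neq0 (F : fieldType) : well_posedness_poly F != 0.
Proof.
have zero_mx (E : {set 'I_n * 'I_n}) : edge_mx (E := E) (fun _ => 0 : F) = 0.
  by apply/matrixP=> i j; rewrite !mxE big1.
apply: contra_neq (oner_neq0 F) => /(congr1 (meval (fun _ => 0))).
rewrite meval_well_posedness_poly /known_mx /unknownL_mx /unknownR_mx !zero_mx.
by rewrite addr0 subr0 det1 mulr1 meval0.
Qed.

Lemma generic_point (F : numFieldType)
    (p : {mpoly F[#|E0| + (#|ED| + #|ED|)]}) : p != 0 ->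
  exists x, [/\ p.@[x] != 0,
                1%:M - (known_mx x + unknownL_mx x) \in unitmx
              & 1%:M - (known_mx x + unknownR_mx x) \in unitmx].
Proof.
move=> nz_p.
have [x] := mpoly_nonroot (mulf_neq0 nz_p (well_posedness_poly_neq0 F)).
rewrite mevalM meval_well_posedness_poly !mulf_eq0 !negb_or.
by case/and3P=> px detL detR; exists x; rewrite !unitmxE !unitfE.
Qed.

End GenericNetwork.

(** * Sensitivity matrix and assignations *)

Section Sensitivity.
Variables (n : nat) (Bs Cs : {set 'I_n}) (E0 ED : {set 'I_n * 'I_n}).
Local Notation edges := {a | a \in ED}.
Local Notation pairs := ({b | b \in Bs} * {c | c \in Cs})%type.
Local Notation edge := (network_edge E0 ED).
Variables (q : 'I_#|ED| -> pairs) (r : pairs -> 'I_#|ED|).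
Hypotheses (qK : cancel q r) (rK : cancel r q).

(** The matrix of the linear map sending the entries of Delta on the unknown edges
    to the entries of T Delta T' at the (measurement, excitation) pairs. The
    bijection q numbers the columns so as to make it square. *)
Definition sensitivity_mx (A : nzRingType) (T T' : 'M[A]_n) : 'M[A]_#|ED| :=
  \matrix_(k, l) (T (val (q l).2) (enum_val k).1
                  * T' (enum_val k).2 (val (q l).1)).

Lemma map_sensitivity_mx (A A' : nzRingType) (f : {rmorphism A -> A'}) T T' :
  map_mx f (sensitivity_mx T T') = sensitivity_mx (map_mx f T) (map_mx f T').
Proof. by apply/matrixP=> k l; rewrite !mxE rmorphM. Qed.

Lemma sensitivity_mxZ (A : comNzRingType) (d d' : A) T T' :
  sensitivity_mx (d *: T) (d' *: T') = (d * d') *: sensitivity_mx T T'.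
Proof. by apply/matrixP=> k l; rewrite !mxE mulrACA. Qed.

Lemma sensitivity_mxE (A : comNzRingType) (T T' : 'M[A]_n) (v : 'rV_#|ED|) l :
  (v *m sensitivity_mx T T') 0 l
  = (T *m edge_mx (v 0) *m T') (val (q l).2) (val (q l).1).
Proof.
rewrite !mxE; under [RHS]eq_bigr => j _.
  rewrite !mxE big_distrl /=; under eq_bigr => i _ do
    rewrite mxE big_distrr big_distrl /=.
  over.
rewrite pair_bigA /=.
rewrite [RHS](exchange_big_dep predT) //=; apply: eq_bigr => k _.
rewrite (big_pred1 ((enum_val k).2, (enum_val k).1)); last first.
  by move=> [j i] /=; rewrite eq_sym; case: (enum_val k) => a b; apply: andbC.
by rewrite !mxE mulrCA mulrA.
Qed.

(** The equation in Delta is v *m sensitivity_mx = 0, where v lists the entries of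
    Delta on the unknown edges. *)
Lemma identifiable_atP (R : realType) (G G' : 'M[complex R]_n) :
  decoupled_identifiable_at Bs Cs ED G G'
  <-> \det (sensitivity_mx (transfer G) (transfer G')) != 0.
Proof.
set T := transfer G; set T' := transfer G'.
have probesE D k l :
    (measurement_mx R Cs *m T *m D *m T' *m excitation_mx R Bs) k l
    = (T *m D *m T') (enum_val k) (enum_val l).
  rewrite mxE (bigD1 (enum_val l)) //= [X in _ * X + _]mxE eqxx mulr1 big1.
    rewrite addr0 -!mulmxA mxE (bigD1 (enum_val k)) //= [X in X * _ + _]mxE eqxx.
    rewrite mul1r big1 ?addr0 // => i /negPf ni.
    by rewrite [X in X * _]mxE ni mul0r.
  by move=> i /negPf ni; rewrite [X in _ * X]mxE ni mulr0.
have probes0 D :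
    measurement_mx R Cs *m T *m D *m T' *m excitation_mx R Bs = 0
    <-> forall l, (T *m D *m T') (val (q l).2) (val (q l).1) = 0.
  split=> [/matrixP D0 l|D0].
    have := D0 (enum_rank_in (valP (q l).2) (val (q l).2))
               (enum_rank_in (valP (q l).1) (val (q l).1)).
    by rewrite probesE [RHS]mxE !enum_rankK_in //; apply: valP.
  apply/matrixP=> k l; rewrite probesE [RHS]mxE.
  pose bc : pairs := (Sub (enum_val l) (enum_valP l), Sub (enum_val k) (enum_valP k)).
  by have := D0 (r bc); rewrite rK.
split=> [ident|detK D suppD /probes0 D0].
  apply/negP => /det0P[v nz_v vK0]; case/eqP: nz_v.
  have /matrixP D0 : edge_mx (v 0) = 0.
    apply: ident => [i j|]; first exact: edge_mx_out.
    by apply/probes0 => l; rewrite -sensitivity_mxE vK0 mxE.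
  by apply/rowP=> k; rewrite -(edge_mx_val (v 0) k) D0 !mxE.
pose v := \row_k D (enum_val (A := ED) k).1 (enum_val k).2.
have vD : edge_mx (v 0) = D.
  by rewrite -[RHS](edge_mxK suppD); apply: eq_edge_mx => k; rewrite mxE.
have v0 : v = 0.
  apply: contraNeq detK => nz_v; apply/det0P; exists v => //.
  by apply/rowP=> l; rewrite sensitivity_mxE vD D0 mxE.
by rewrite -vD v0; apply/matrixP=> i j; rewrite !mxE big1 // => k _; rewrite mxE.
Qed.

Lemma rmorph_det_sensitivity (A A' : comNzRingType) (f : {rmorphism A -> A'})
    (G G' : 'M[A]_n) :
  f (\det (sensitivity_mx (\adj (1%:M - G)) (\adj (1%:M - G'))))
  = \det (sensitivity_mx (\adj (1%:M - map_mx f G)) (\adj (1%:M - map_mx f G'))).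
Proof.
by rewrite -det_map_mx map_sensitivity_mx !map_mx_adj !map_mxB !map_mx1.
Qed.

(** Adjugates stand for the inverses: on well-posed networks they differ from them
    by nonzero scalars, and their entries are polynomials. *)
Definition sensitivity_poly (F : fieldType) :=
  \det (sensitivity_mx (\adj (1%:M - genericL E0 ED F))
                       (\adj (1%:M - genericR E0 ED F))).

Lemma meval_sensitivity_poly (F : fieldType) (x : _ -> F) :
  (sensitivity_poly F).@[x]
  = \det (sensitivity_mx (\adj (1%:M - (known_mx x + unknownL_mx x)))
                         (\adj (1%:M - (known_mx x + unknownR_mx x)))).
Proof.
rewrite -meval_genericL -meval_genericR.
exact: (rmorph_det_sensitivity (meval x)).
Qed.

Definition edge_of (k : 'I_#|ED|) : edges := Sub (enum_val k) (enum_valP k).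
Definition rank_of (a : edges) : 'I_#|ED| := enum_rank_in (valP a) (val a).

Lemma edge_ofK : cancel edge_of rank_of.
Proof. by move=> k; rewrite /rank_of /= enum_valK_in. Qed.

Lemma rank_ofK : cancel rank_of edge_of.
Proof. by move=> a; apply: val_inj; apply: enum_rankK_in (valP a). Qed.

Definition assignation_of (s : 'S_#|ED|) : assignation ED Bs Cs :=
  [ffun a => q (s (rank_of a))].

Lemma assignation_of_bij s : bijective (assignation_of s).
Proof.
exists (fun bc => edge_of ((s^-1)%g (r bc))) => [a|bc].
  by rewrite ffunE qK permK rank_ofK.
by rewrite ffunE edge_ofK permKV rK.
Qed.

Lemma assignation_of_inj : injective assignation_of.
Proof.
move=> s s' eq_ss'; apply/permP=> k; apply: (can_inj qK).
by have /ffunP/(_ (edge_of k)) := eq_ss'; rewrite !ffunE edge_ofK.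
Qed.

Lemma assignation_of_surj (sigma : assignation ED Bs Cs) :
  bijective sigma -> exists s, sigma = assignation_of s.
Proof.
move=> sigma_bij; have f_inj : injective (fun k => r (sigma (edge_of k))).
  move=> k l /(can_inj rK)/(bij_inj sigma_bij); exact: (can_inj edge_ofK).
by exists (perm f_inj); apply/ffunP=> a; rewrite ffunE permE rK rank_ofK.
Qed.

Lemma connected_assignation_of s :
  connected_assignation E0 (assignation_of s)
  <-> forall k, connect edge (val (q (s k)).1) (enum_val k).2
                && connect edge (enum_val k).1 (val (q (s k)).2).
Proof.
split=> [conn k|conn a].
  have := conn (edge_of k); rewrite ffunE edge_ofK.
  by move/path_throughP; apply; apply: enum_valP.
apply/path_throughP; first exact: valP.
have := conn (rank_of a); rewrite ffunE.
by have /(congr1 val) /= -> := rank_ofK a.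
Qed.

Section Determinant.
Variables (F : fieldType) (T T' : 'M[F]_n).

(** A permutation whose Leibniz product is nonzero is a connected assignation, as
    each factor of the product provides the two halves of a path. *)
Lemma connected_of_term (s : 'S_#|ED|) :
    (forall c i, T c i != 0 -> connect edge i c) ->
    (forall c i, T' c i != 0 -> connect edge i c) ->
    \prod_k sensitivity_mx T T' k (s k) != 0 ->
  connected_assignation E0 (assignation_of s).
Proof.
move=> suppT suppT' /prodf_neq0 nz_s; apply/connected_assignation_of => k.
have := nz_s k isT; rewrite mxE mulf_eq0 negb_or => /andP[/suppT -> /suppT' ->].
by [].
Qed.

Lemma exists_connected :
    (forall c i, T c i != 0 -> connect edge i c) ->
    (forall c i, T' c i != 0 -> connect edge i c) ->
    \det (sensitivity_mx T T') != 0 ->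
  exists s, connected_assignation E0 (assignation_of s).
Proof.
move=> suppT suppT' detK.
have [s nz_s] : exists s : 'S_#|ED|, \prod_k sensitivity_mx T T' k (s k) != 0.
  apply/existsP; apply: contraNT detK => /existsPn no_s.
  rewrite /determinant big1 // => s _.
  by have /negPn/eqP -> := no_s s; rewrite mulr0.
by exists s; apply: connected_of_term nz_s.
Qed.

(** All Leibniz terms but one vanish, and the remaining one is a product of
    nonzero entries. *)
Lemma det_unique_connected :
    (forall c i, (T c i != 0) = connect edge i c) ->
    (forall c i, (T' c i != 0) = connect edge i c) ->
    (exists! sigma : assignation ED Bs Cs,
       connected_bijective_assignation E0 sigma) ->
  \det (sensitivity_mx T T') != 0.
Proof.
move=> suppT suppT' [_ [[/assignation_of_surj[s ->] conn] uniq_s]].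
rewrite /determinant (bigD1 s) //= [X in _ + X]big1 ?addr0 => [|s' ns's].
  rewrite mulf_neq0 ?signr_eq0 //; apply/prodf_neq0 => k _.
  have /connected_assignation_of/(_ k)/andP[bk kc] := conn.
  by rewrite mxE mulf_neq0 ?suppT ?suppT'.
apply/eqP; apply: contraNT ns's; rewrite mulf_eq0 signr_eq0 => nz_s'.
apply/eqP/assignation_of_inj/esym/uniq_s; split; first exact: assignation_of_bij.
by apply: connected_of_term nz_s' => c i; rewrite ?suppT ?suppT'.
Qed.

End Determinant.
End Sensitivity.

Lemma ex_pair_index n (Bs Cs : {set 'I_n}) (ED : {set 'I_n * 'I_n}) :
    #|ED| = (#|Bs| * #|Cs|)%N ->
  exists q : 'I_#|ED| -> {b | b \in Bs} * {c | c \in Cs}, bijective q.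
Proof.
move=> cardED; pose P := ({b | b \in Bs} * {c | c \in Cs})%type.
have cardP : #|ED| = #|{: P}| by rewrite card_prod !card_sig.
exists (fun k => enum_val (cast_ord cardP k)).
exists (fun bc => cast_ord (esym cardP) (enum_rank bc)) => [k|bc].
  by rewrite enum_valK cast_ordK.
by rewrite cast_ordKV enum_rankK.
Qed.

(** * Genericity *)

Section Genericity.
Variables (R : realType) (n : nat) (Bs Cs : {set 'I_n}).
Variables (E0 ED : {set 'I_n * 'I_n}).
Local Notation C := (complex R).
Variables (q : 'I_#|ED| -> {b | b \in Bs} * {c | c \in Cs}).
Variable r : {b | b \in Bs} * {c | c \in Cs} -> 'I_#|ED|.
Hypotheses (qK : cancel q r) (rK : cancel r q).

Lemma connected_of_generic :
    generically_decoupled_identifiable R Bs Cs E0 ED ->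
  exists s, connected_assignation E0 (assignation_of q s).
Proof.
move=> [p nz_p ident]; have [x [px wpG wpG']] := generic_point nz_p.
set G := _ + unknownL_mx x in wpG; set G' := _ + unknownR_mx x in wpG'.
have detK : \det (sensitivity_mx q (transfer G) (transfer G')) != 0.
  apply/(identifiable_atP rK).
  apply: ident wpG wpG'.
  - exact: supported_edge_mx.
  - exact: supported_edge_mx.
  - exact: supported_edge_mx.
  by rewrite (meval_eq _ (parameters_surj x)).
have supp (y : 'I_#|ED| -> C) i j : (known_mx x + edge_mx y) i j != 0 ->
    network_edge E0 ED j i.
  rewrite /network_edge inE; apply: contraR; rewrite negb_or => /andP[ij0 ijD].
  by rewrite mxE /known_mx !edge_mx_out ?addr0.
apply: exists_connected detK => c i.
  exact: (invmx_support (supp _) wpG).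
exact: (invmx_support (supp _) wpG').
Qed.

Lemma generic_of_unique :
    [disjoint E0 & ED] ->
    (exists! sigma : assignation ED Bs Cs,
       connected_bijective_assignation E0 sigma) ->
  generically_decoupled_identifiable R Bs Cs E0 ED.
Proof.
move=> disjE uniq_sigma.
pose p := sensitivity_poly E0 q C.
have pE G0 GD GD' : supported E0 G0 -> supported ED GD -> supported ED GD' ->
    p.@[parameters (E0 := E0) (ED := ED) G0 GD GD']
    = \det (sensitivity_mx q (\adj (1%:M - (G0 + GD))) (\adj (1%:M - (G0 + GD')))).
  move=> s0 sD sD'; rewrite meval_sensitivity_poly.
  by have [-> -> ->] := parametersK s0 sD sD'.
exists p.
  (* The polynomial does not vanish when every edge has the weight z; as E0 and ED
     are disjoint, both matrices of the pair are then W (E0 :|: ED). *)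
  have [z adjE] := uniform_weights R (E0 :|: ED).
  pose W (E : {set 'I_n * 'I_n}) : 'M[C]_n := \matrix_(i, j) (z *+ ((i, j) \in E)).
  have suppW E : supported E (W E) by move=> i j /negPf ijE; rewrite mxE ijE.
  have sumW : W E0 + W ED = W (E0 :|: ED).
    apply/matrixP=> i j; rewrite !mxE inE -mulrnDr; congr (_ *+ _).
    by case E0ij: (_ \in E0); rewrite // (disjointFr disjE E0ij).
  have : p.@[parameters (E0 := E0) (ED := ED) (W E0) (W ED) (W ED)] != 0.
    by rewrite pE // sumW; apply: (det_unique_connected qK rK _ _ uniq_sigma).
  by apply: contraNneq => ->; rewrite meval0.
move=> G0 GD GD' s0 sD sD'; rewrite pE // /well_posed => px wpG wpG'.
apply/(identifiable_atP rK); apply: contraNneq px.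
rewrite /transfer /invmx wpG wpG' sensitivity_mxZ detZ => /eqP.
rewrite unitmxE unitfE in wpG; rewrite unitmxE unitfE in wpG'.
rewrite mulf_eq0 expf_eq0 mulf_eq0 !invr_eq0 (negPf wpG) (negPf wpG') andbF.
by [].
Qed.
End Genericity.

Theorem mainTheorem5 (R : realType) (n : nat) (Bs Cs : {set 'I_n})
  (E0 ED : {set 'I_n * 'I_n})
  (disjE : [disjoint E0 & ED])
  (cardED : #|ED| = (#|Bs| * #|Cs|)%N) :
  (generically_decoupled_identifiable R Bs Cs E0 ED ->
   exists sigma : assignation ED Bs Cs,
     connected_bijective_assignation E0 sigma)
  /\
  ((exists! sigma : assignation ED Bs Cs,
      connected_bijective_assignation E0 sigma) ->
   generically_decoupled_identifiable R Bs Cs E0 ED).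
Proof.
have [q [r qK rK]] := ex_pair_index cardED.
split; last exact: (generic_of_unique R qK rK disjE).
move=> /(connected_of_generic rK)[s conn].
by exists (assignation_of q s); split; first exact: (assignation_of_bij qK rK).
Qed.
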